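(* Let $K$ be a field of characteristic $\ne2$ and let $a\in K^\times$. The first étale $\mathbb{Z}/2$-homology obstruction for the existence of a $K$-rational point on the variety $X\colon ax^2=1$ is precisely the class $[a]\in H^1(K,\mathbb{Z}/2)$.
   Context: $[a]$ denotes the class of $a$ in $H^1(K,\mathbb{Z}/2)\cong K^\times/(K^\times)^2$; $\Gamma_K$ is the absolute Galois group of $K$. For a $K$-variety $X$, its relative étale homotopy type $\mathrm{Et}_{/K}(X)$ is the pro-object in spaces with $\Gamma_K$-action given by the inverse system, over étale hypercoverings $U_\bullet\to X$, of the simplicial $\Gamma_K$-sets $\pi_0(\overline{U}_\bullet)$, where $\overline{U}_\bullet$ is the base change of $U_\bullet$ to the separable closure. Let $C=\mathbb{Z}/2\otimes\mathrm{Et}_{/K}(X)$ be its $\mathbb{Z}/2$-chains, with augmentation $C\to\mathbb{Z}/2$ and fibre $F$ (reduced chains). If the homology of $F$ vanishes in degrees $<d$, the $(d+1)$-st étale $\mathbb{Z}/2$-homology obstruction to a rational point is the class in $H^{d+1}(\Gamma_K,H_d(F))$ obstructing a lift of the ($\Gamma_K$-fixed) element $1\in\mathbb{Z}/2$ to a homotopy fixed point of the truncation $P_{\le d}C$, i.e. the image of $1\in H^0(\Gamma_K,\mathbb{Z}/2)$ under the connecting map of $H_d(F)[d]\to P_{\le d}C\to\mathbb{Z}/2$. For $X\colon ax^2=1$ one has $d=0$ and $H_0(F)\cong\mathbb{Z}/2$. *)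

(* Defs.v *)
From HB Require Import structures.
From mathcomp Require Import all_boot all_algebra all_field.
From mathcomp Require Import ring_quotient boolp freeg.

Set Implicit Arguments.
Unset Strict Implicit.
Unset Printing Implicit Defensive.

Import GRing.Theory.
Local Open Scope ring_scope.
Local Open Scope quotient_scope.

Definition is_separable_closure (K Ks : fieldType) (iota : {rmorphism K -> Ks}) :=
  (forall x : Ks, exists2 p : {poly K}, separable_poly p & root (map_poly iota p) x)
  /\ (forall p : {poly Ks}, separable_poly p -> size p != 1 -> exists x, root p x).

Section ZmodMorphism.
Variables (U V : zmodType) (f : U -> V) (fB : zmod_morphism f).

Lemma zmorph0 : f 0 = 0.
Proof. by rewrite -(subrr 0) fB subrr. Qed.
Lemma zmorphN x : f (- x) = - f x.
Proof. by rewrite -sub0r fB zmorph0 sub0r. Qed.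
Lemma zmorphD x y : f (x + y) = f x + f y.
Proof. by rewrite -[in LHS](opprK y) fB zmorphN opprK. Qed.

End ZmodMorphism.

Record absGal (K Ks : fieldType) (iota : {rmorphism K -> Ks}) := AbsGal {
  gal :> Ks -> Ks;
  gal_zmod : zmod_morphism gal;
  gal_monoid : monoid_morphism gal;
  gal_fix : forall k, gal (iota k) = iota k;
  gal_surj : forall y, exists x, gal x = y }.

Section AbsGalGroup.
Variables (K Ks : fieldType) (iota : {rmorphism K -> Ks}).
Local Notation Gam := (absGal iota).
Implicit Types s t : Gam.

Lemma gal_eqP s t : s =1 t -> s = t.
Proof.
case: s t => f1 a1 b1 c1 d1 [f2 a2 b2 c2 d2] /= /funext e; subst f2.
by congr AbsGal; exact: Prop_irrelevance.
Qed.

Lemma gal_inj s : injective s.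
Proof.
pose m := GRing.isZmodMorphism.Build _ _ _ (gal_zmod s).
pose m' := GRing.isMonoidMorphism.Build _ _ _ (gal_monoid s).
pose f : {rmorphism Ks -> Ks} := HB.pack (gal s) m m'.
exact: (fmorph_inj f).
Qed.

Definition gal_one : Gam.
Proof. by exists id => //= y; exists y. Defined.

Definition gal_mul s t : Gam.
Proof.
exists (s \o t).
- by move=> x y /=; rewrite !gal_zmod.
- split=> [|x y] /=; first by rewrite !(gal_monoid _).1.
  by rewrite !(gal_monoid _).2.
- by move=> k /=; rewrite !gal_fix.
- move=> y; have [x <-] := gal_surj s y; have [z <-] := gal_surj t x.
  by exists z.
Defined.

Definition gal_inv_fun s (y : Ks) : Ks := sval (cid (gal_surj s y)).

Lemma gal_inv_funK s : cancel (gal_inv_fun s) s.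
Proof. by move=> y; rewrite /gal_inv_fun; case: cid. Qed.

Definition gal_inv s : Gam.
Proof.
exists (gal_inv_fun s).
- move=> x y; apply: (@gal_inj s); by rewrite gal_zmod !gal_inv_funK.
- split=> [|x y]; apply: (@gal_inj s).
    by rewrite gal_inv_funK (gal_monoid s).1.
  by rewrite (gal_monoid s).2 !gal_inv_funK.
- by move=> k; apply: (@gal_inj s); rewrite gal_inv_funK gal_fix.
- by move=> y; exists (s y); apply: (@gal_inj s); rewrite gal_inv_funK.
Defined.

HB.instance Definition _ := gen_eqMixin Gam.
HB.instance Definition _ := gen_choiceMixin Gam.

Fact gal_mulA : associative gal_mul.
Proof. by move=> s t u; apply: gal_eqP. Qed.
Fact gal_mul1 : left_id gal_one gal_mul.
Proof. by move=> s; apply: gal_eqP. Qed.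
Fact gal_mulr1 : right_id gal_one gal_mul.
Proof. by move=> s; apply: gal_eqP. Qed.
Fact gal_mulV : left_inverse gal_one gal_inv gal_mul.
Proof.
by move=> s; apply: gal_eqP => x; apply: (@gal_inj s); rewrite /= gal_inv_funK.
Qed.
Fact gal_mulrV : right_inverse gal_one gal_inv gal_mul.
Proof. by move=> s; apply: gal_eqP => x; rewrite /= gal_inv_funK. Qed.

HB.instance Definition _ := isGroup.Build Gam
  gal_mulA gal_mul1 gal_mulr1 gal_mulV gal_mulrV.

(** Continuity for the Krull topology, the target being discrete: the stabilisers
    of finite subsets of [Ks] form a basis of neighbourhoods of 1. *)
Definition locally_constant (T : Type) (f : Gam -> T) :=
  forall s, exists xs : seq Ks, forall t, {in xs, s =1 t} -> f t = f s.

(** The stabiliser of [x] is open; modules and sets with this property for all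
    [x] are the discrete ones. *)
Definition smooth (T : Type) (act : Gam -> T -> T) (x : T) :=
  exists xs : seq Ks, forall s, {in xs, s =1 id} -> act s x = x.

Record gmodule := GModule {
  gm_sort :> zmodType;
  gact : Gam -> gm_sort -> gm_sort;
  gactB : forall s, zmod_morphism (gact s);
  gact1 : forall x, gact 1%g x = x;
  gactM : forall s t x, gact (s * t)%g x = gact s (gact t x);
  gact_smooth : forall x, smooth gact x }.

Record gmodule_hom (M N : gmodule) := GModuleHom {
  gmh :> M -> N;
  gmhB : zmod_morphism gmh;
  gmh_act : forall s x, gmh (gact s x) = gact s (gmh x) }.

Record cocycle (M : gmodule) := Cocycle {
  coc :> Gam -> M;
  coc_continuous : locally_constant coc;
  cocM : forall s t, coc (s * t)%g = coc s + gact s (coc t) }.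

HB.instance Definition _ M := gen_eqMixin (cocycle M).
HB.instance Definition _ M := gen_choiceMixin (cocycle M).

Definition cohomologous (M : gmodule) : rel (cocycle M) := fun z w =>
  `[< exists m : M, forall s, z s - w s = gact s m - m >].

Lemma cohomologous_equiv M : equiv_class_of (@cohomologous M).
Proof.
split=> [z|z w|w z v].
- by apply/asboolP; exists 0 => s; rewrite (zmorph0 (gactB s)) !subrr.
- by apply/idP/idP => /asboolP[m hm]; apply/asboolP; exists (- m) => s;
    rewrite (zmorphN (gactB s)) -opprD -hm opprB.
- move=> /asboolP[m hm] /asboolP[n hn]; apply/asboolP; exists (m + n) => s.
  by rewrite (zmorphD (gactB s)) -(subrKA (w s)) hm hn opprD addrACA.
Qed.

Canonical cohomologous_equivRel M := EquivRelPack (@cohomologous_equiv M).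

Definition H1 (M : gmodule) := {eq_quot (@cohomologous M)}.
HB.instance Definition _ M : EqQuotient _ (@cohomologous M) (H1 M) :=
  EqQuotient.on (H1 M).

Definition cocycle_map (M N : gmodule) (phi : gmodule_hom M N) (z : cocycle M) :
  cocycle N.
Proof.
exists (phi \o z) => [s|s t /=].
  have [xs h] := coc_continuous z s.
  by exists xs => t /h /= ->.
by rewrite cocM (zmorphD (gmhB phi)) gmh_act.
Defined.

Definition H1_map (M N : gmodule) (phi : gmodule_hom M N) (c : H1 M) : H1 N :=
  \pi_(H1 N) (cocycle_map phi (repr c)).

(** For an exact sequence [0 -> M' --i--> M --p--> M'' -> 0] and an invariant
    [x] of [M''], [connecting i p x c] says that [c] is the image of [x] under
    the connecting map [H^0(M'') -> H^1(M')]. *)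
Definition connecting (M' M M'' : gmodule) (i : gmodule_hom M' M)
    (p : gmodule_hom M M'') (x : M'') (c : H1 M') :=
  exists (m : M) (z : cocycle M'),
    [/\ p m = x, forall s, i (z s) = gact s m - m & c = \pi_(H1 M') z].

Definition gmodZ2 : gmodule := @GModule 'F_2 (fun _ => id)
  (fun _ _ _ => erefl) (fun _ => erefl) (fun _ _ _ => erefl)
  (fun _ => ex_intro _ [::] (fun _ _ => erefl)).

End AbsGalGroup.

(** A scheme is étale over a field [k] if and only if it is a disjoint union of
    spectra of finite separable extensions of [k]; [pts] is its underlying
    (discrete) space and [fld i] the residue field at [i]. *)
Record etale (k : fieldType) := Etale {
  pts : Type;
  fld : pts -> fieldExtType k;
  fld_sep : forall i, separable 1%AS {: fld i} }.

Record embedding (k E : fieldType) (j : {rmorphism k -> E}) (L : fieldExtType k) :=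
  Embedding {
    emb :> L -> E;
    emb_zmod : zmod_morphism emb;
    emb_monoid : monoid_morphism emb;
    emb_scalar : forall c, emb c%:A = j c }.

(** [U(E)], for an extension field [j : k -> E] of [k]. *)
Definition field_point (k E : fieldType) (j : {rmorphism k -> E}) (U : etale k) :=
  {i : pts U & embedding j (fld i)}.

(** Spectra of fields are connected, so the components are indexed by [pts U]. *)
Definition pi0 (k : fieldType) (U : etale k) := pts U.

Section BaseChange.
Variables (K Ks : fieldType) (iota : {rmorphism K -> Ks}).
Local Notation Gam := (absGal iota).

Fact regular_separable (E : fieldType) : separable (1%AS : {subfield E^o}) {: E^o}.
Proof.
apply/separableP => y _; apply: base_separable.
by apply/vlineP; exists y; rewrite /GRing.scale /= mulr1.
Qed.

(** The base change of [U] to the separable closure [Ks] is a disjoint union of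
    copies of [Spec Ks], one for each [i] and each [K]-embedding [fld i -> Ks];
    see [base_changeP] for its universal property. *)
Definition base_change (U : etale K) : etale Ks :=
  @Etale Ks (field_point iota U) (fun _ => Ks^o : fieldExtType Ks) (fun _ => regular_separable Ks).

Lemma emb_eqP (k E : fieldType) (j : {rmorphism k -> E}) (L : fieldExtType k)
  (f g : embedding j L) : f =1 g -> f = g.
Proof.
case: f g => f1 a1 b1 c1 [f2 a2 b2 c2] /= /funext e; subst f2.
by congr Embedding; exact: Prop_irrelevance.
Qed.

Definition gal_emb (s : Gam) (L : fieldExtType K) (f : embedding iota L) :
  embedding iota L.
Proof.
exists (s \o f).
- by move=> x y /=; rewrite emb_zmod gal_zmod.
- split=> [|x y] /=; first by rewrite (emb_monoid f).1 (gal_monoid s).1.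
  by rewrite (emb_monoid f).2 (gal_monoid s).2.
- by move=> c /=; rewrite emb_scalar gal_fix.
Defined.

(** The action of [Gam] on [pi_0] of the base change; on the component of an
    embedding [f] it is [s . f = s \o f]. *)
Definition pi0_act (U : etale K) (s : Gam) (x : pi0 (base_change U)) :
  pi0 (base_change U) := existT _ (projT1 x) (gal_emb s (projT2 x)).

Lemma pi0_act1 U x : @pi0_act U 1%g x = x.
Proof. by case: x => i f; congr existT; apply: emb_eqP. Qed.

Lemma pi0_actM U s t x : @pi0_act U (s * t)%g x = pi0_act s (pi0_act t x).
Proof. by case: x => i f; congr existT; apply: emb_eqP. Qed.

Lemma pi0_act_smooth U x : smooth (@pi0_act U) x.
Proof.
case: x => i f; exists [seq f b | b <- vbasis {: fld i}] => s hs.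
congr existT; apply: emb_eqP => x /=.
have fZ c y : f (c *: y) = iota c * f y.
  by rewrite -mulr_algl (emb_monoid f).2 emb_scalar.
rewrite (coord_vbasis (memvf x)).
have sum0 (g : fld i -> Ks) : zmod_morphism g -> forall (h : 'I_(\dim {: fld i}) -> fld i),
    g (\sum_j h j) = \sum_j g (h j).
  move=> gB h; exact: (big_morph g (zmorphD gB) (zmorph0 gB)).
have sum1 (h : 'I_(\dim {: fld i}) -> Ks) : s (\sum_j h j) = \sum_j s (h j).
  exact: (big_morph s (zmorphD (gal_zmod s)) (zmorph0 (gal_zmod s))).
rewrite (sum0 _ (emb_zmod f)) sum1; apply: eq_bigr => j _ /=; rewrite !fZ (gal_monoid s).2 gal_fix; congr (_ * _).
by apply: hs; apply: map_f; rewrite mem_nth // size_tuple.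
Qed.

End BaseChange.

Section BaseChangeUniversal.
Variables (K Ks : fieldType) (iota : {rmorphism K -> Ks}).
Hypothesis iotaP : is_separable_closure iota.
Variables (E : fieldType) (j : {rmorphism Ks -> E}) (U : etale K).

Lemma sepclosed_splits (p : {poly Ks}) : separable_poly p ->
  exists rs : seq Ks, p %= \prod_(r <- rs) ('X - r%:P).
Proof.
have [n] := ubnP (size p); elim: n p => // n IH p; rewrite ltnS => le_pn sp.
have p0 := separable_poly_neq0 sp.
have [/eqP s1 | s1] := boolP (size p == 1).
  by exists [::]; rewrite big_nil -size_poly_eq1 s1.
have [r /factor_theorem[q pq]] := iotaP.2 _ sp s1.
have q0 : q != 0 by apply: contraNneq p0 => q0; rewrite pq q0 mul0r.
have sq : separable_poly q by apply: dvdp_separable sp; rewrite pq dvdp_mulr.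
have [|rs hrs] := IH q _ sq.
  by apply: leq_trans le_pn; rewrite pq size_Mmonic ?monicXsubC // size_XsubC addn2.
by exists (r :: rs); rewrite big_cons pq mulrC eqp_mull.
Qed.

Lemma embedding_image (i : pts U) (g : embedding (j \o iota : {rmorphism K -> E}) (fld i))
  (x : fld i) : exists y, j y = g x.
Proof.
have /separableP/(_ x (memvf x)) sx := fld_sep i.
have /polyOver1P [p hp] := minPolyOver 1%AS x.
have sp : separable_poly p.
  by move: sx; rewrite /separable_element hp separable_map.
have [rs hrs] := @sepclosed_splits (map_poly iota p) (etrans (separable_map _ _) sp).
pose m := GRing.isZmodMorphism.Build _ _ _ (emb_zmod g).
pose m' := GRing.isMonoidMorphism.Build _ _ _ (emb_monoid g).
pose g' : {rmorphism fld i -> E} := HB.pack (emb g) m m'.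
have : root (map_poly j (map_poly iota p)) (g x).
  rewrite -map_poly_comp.
  have -> : map_poly (j \o iota) p = map_poly g' (map_poly (in_alg (fld i)) p).
    by rewrite -map_poly_comp; apply: eq_map_poly => c /=; rewrite emb_scalar.
  by rewrite -hp (fmorph_root g') root_minPoly.
have : map_poly j (map_poly iota p) %= map_poly j (\prod_(r <- rs) ('X - r%:P)).
  by rewrite eqp_map.
move=> /eqp_root ->; rewrite rmorph_prod.
under eq_bigr do rewrite /= map_polyXsubC.
rewrite -(big_map j xpredT (fun z => 'X - z%:P)) root_prod_XsubC.
by move=> /mapP[r _ ->]; exists r.
Qed.

(** The projection [base_change iota U -> U] on [E]-points. *)
Definition base_change_proj (y : field_point j (base_change iota U)) :
  field_point (j \o iota : {rmorphism K -> E}) U.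
Proof.
case: y => -[i f] h; exists i; exists (h \o f) => [u v|//|c] /=.
- by rewrite emb_zmod (emb_zmod h).
- split=> [|u v] /=; first by rewrite (emb_monoid f).1 (emb_monoid h).1.
  by rewrite (emb_monoid f).2 (emb_monoid h).2.
- rewrite emb_scalar -(emb_scalar h); congr (h _).
  by rewrite /GRing.scale /= mulr1.
Defined.

(** The universal property of the base change, on points with values in an
    arbitrary extension field [E] of [Ks]. *)
Lemma base_changeP : forall x, exists! y, base_change_proj y = x.
Proof.
have hE (h : embedding j (Ks^o : fieldExtType Ks)) z : h z = j z.
  by rewrite -(emb_scalar h) /GRing.scale /= mulr1.
move=> [i g]; pose f z := sval (cid (embedding_image g z)).
have jf z : j (f z) = g z by rewrite /f; case: cid.
have fB : zmod_morphism f.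
  by move=> u v; apply: (fmorph_inj j); rewrite rmorphB !jf emb_zmod.
have fM : monoid_morphism f.
  split=> [|u v]; apply: (fmorph_inj j).
    by rewrite jf (emb_monoid g).1 rmorph1.
  by rewrite rmorphM !jf (emb_monoid g).2.
have fZ c : f c%:A = iota c.
  by apply: (fmorph_inj j); rewrite jf emb_scalar.
pose F := Embedding fB fM fZ.
have jB : zmod_morphism (j : Ks^o -> E) by exact: rmorphB.
have jM : monoid_morphism (j : Ks^o -> E).
  by split=> [|u v]; rewrite ?rmorph1 ?rmorphM.
have jZ c : j (c%:A : Ks^o) = j c by rewrite /GRing.scale /= mulr1.
pose J : embedding j (Ks^o : fieldExtType Ks) := @Embedding _ _ j (Ks^o) _ jB jM jZ.
exists (existT _ (existT _ i F) J); split.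
  by congr existT; apply: emb_eqP => z /=; rewrite jf.
move=> [[i' F'] J'] H; have e : i' = i := congr1 (@projT1 _ _) H.
subst i'; move: (projT2_eq H); rewrite (Prop_irrelevance (projT1_eq H) erefl) /= => Hg.
have -> : F = F'.
  apply: emb_eqP => z; apply: (fmorph_inj j).
  by rewrite /= jf -[g z]/(emb g z) -Hg /= hE.
by congr existT; apply: emb_eqP => z; rewrite hE.
Qed.

End BaseChangeUniversal.

Section EtaleX.
Variables (K : fieldType) (a : K).

Definition X_point (L : fieldExtType K) (x : L) := a%:A * x ^+ 2 = 1.

(** Étale [X]-schemes: since [X] is étale over [K] (for [2 != 0] and [a != 0]), these are the étale
    [K]-schemes [U] with a [K]-morphism [U -> X], i.e. with an [X]-point over the
    residue field of every point of [U]. *)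
Record etaleX := EtaleX {
  esch :> etale K;
  pt_coord : forall i : pts esch, fld i;
  pt_coordP : forall i, X_point (pt_coord i) }.

Record homX (V U : etaleX) := HomX {
  hpt : pts V -> pts U;
  hfld : forall i, 'AHom(fld (hpt i), fld i);
  hover : forall i, hfld i (pt_coord (hpt i)) = pt_coord i }.

Definition idX U : homX U U.
Proof. by exists id (fun i => \1%AF) => i; rewrite id_lfunE. Defined.

Definition compX W V U (f : homX V U) (g : homX W V) : homX W U.
Proof.
exists (fun i => hpt f (hpt g i)) (fun i => (hfld g i \o hfld f (hpt g i))%AF) => i.
by rewrite comp_lfunE !hover.
Defined.

Definition surjectiveX V U (f : homX V U) := forall i, exists j, hpt f j = i.

(** The simplex category: [Simplex m n] is the set of monotone maps [[m] -> [n]]. *)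
Definition monotone m n (f : {ffun 'I_m.+1 -> 'I_n.+1}) :=
  [forall i : 'I_m.+1, forall j : 'I_m.+1, (i <= j)%N ==> (f i <= f j)%N].
Definition Simplex m n := {f : {ffun 'I_m.+1 -> 'I_n.+1} | monotone f}.

Lemma monotoneP m n (f : {ffun 'I_m.+1 -> 'I_n.+1}) :
  reflect (forall i j : 'I_m.+1, (i <= j -> f i <= f j)%N) (monotone f).
Proof.
by apply: (iffP forallP) => [h i j|h i];
  [apply/implyP; exact: (forallP (h i)) | apply/forallP => j; apply/implyP/h].
Qed.

Definition simp_id n : Simplex n n.
Proof. by exists [ffun i => i]; apply/monotoneP => i j; rewrite !ffunE. Defined.

Definition simp_comp l m n (f : Simplex m n) (g : Simplex l m) : Simplex l n.
Proof.
exists [ffun i => val f (val g i)]; apply/monotoneP => i j ij; rewrite !ffunE.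
exact: (monotoneP _ (valP f)) _ _ ((monotoneP _ (valP g)) _ _ ij).
Defined.

(** The coface that omits [i]. *)
Definition coface n (i : 'I_n.+2) : Simplex n n.+1.
Proof.
exists [ffun j => fintype.lift i j]; apply/monotoneP => j k jk; rewrite !ffunE /=.
by rewrite leq_bump2.
Defined.

Record simplicialX := SimplicialX {
  sx :> nat -> etaleX;
  sx_map : forall m n, Simplex m n -> homX (sx n) (sx m);
  sx_id : forall n, sx_map (simp_id n) = idX (sx n);
  sx_comp : forall l m n (f : Simplex m n) (g : Simplex l m),
    sx_map (simp_comp f g) = compX (sx_map g) (sx_map f) }.

(** [T]-valued points of [(cosk_{n-1} sk_{n-1} U)_n], the coskeleton being taken
    over [X]: the limit of the [U_m] over the maps [[m] -> [n]] with [m < n]. For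
    [n = 0] there is exactly one, because [cosk_{-1}] is [X] itself. *)
Record cosk_point (U : simplicialX) (n : nat) (T : etaleX) := CoskPoint {
  cosk_val : forall m, (m < n)%N -> Simplex m n -> homX T (U m);
  cosk_compat : forall l m (hl : (l < n)%N) (hm : (m < n)%N)
    (f : Simplex m n) (g : Simplex l m),
    cosk_val hl (simp_comp f g) = compX (sx_map U g) (cosk_val hm f) }.

(** [U_n -> (cosk_{n-1} sk_{n-1} U)_n] is an étale covering: every [T]-point of
    the target lifts to [U_n] after a surjective étale base change [T' -> T]. *)
Definition cosk_covering (U : simplicialX) (n : nat) :=
  forall (T : etaleX) (b : cosk_point U n T),
  exists (T' : etaleX) (p : homX T' T) (s : homX T' (U n)),
    surjectiveX p /\ forall m (hm : (m < n)%N) (f : Simplex m n),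
      compX (sx_map U f) s = compX (cosk_val b hm f) p.

Record hypercovering := Hypercovering {
  hc :> simplicialX;
  hc_covering : forall n, cosk_covering hc n }.

Record hc_hom (V U : hypercovering) := HcHom {
  hch : forall n, homX (V n) (U n);
  hch_natural : forall m n (f : Simplex m n),
    compX (hch m) (sx_map V f) = compX (sx_map U f) (hch n) }.

End EtaleX.

Section SimplicialGset.
Variables (K Ks : fieldType) (iota : {rmorphism K -> Ks}).
Local Notation Gam := (absGal iota).

Record simplicial_gset := SimplicialGset {
  sg :> nat -> Type;
  sg_map : forall m n, Simplex m n -> sg n -> sg m;
  sg_act : forall n, Gam -> sg n -> sg n;
  sg_id : forall n x, sg_map (simp_id n) x = x;
  sg_comp : forall l m n (f : Simplex m n) (g : Simplex l m) x,
    sg_map (simp_comp f g) x = sg_map g (sg_map f x);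
  sg_act1 : forall n (x : sg n), sg_act 1%g x = x;
  sg_actM : forall n s t (x : sg n), sg_act (s * t)%g x = sg_act s (sg_act t x);
  sg_smooth : forall n (x : sg n), smooth (@sg_act n) x;
  sg_map_act : forall m n (f : Simplex m n) s x,
    sg_map f (sg_act s x) = sg_act s (sg_map f x) }.

Record sgset_hom (S T : simplicial_gset) := SgsetHom {
  sgh : forall n, S n -> T n;
  sgh_map : forall m n (f : Simplex m n) x,
    sgh (sg_map f x) = sg_map f (sgh x);
  sgh_act : forall n s (x : S n), sgh (sg_act s x) = sg_act s (sgh x) }.

Definition free2 (T : Type) := {freeg {classic T} / 'F_2}.

Definition free2_gen (T : Type) (x : T) : free2 T :=
  Freeg [:: (1%R : 'F_2, x : {classic T})].

Definition free2_map (T T' : Type) (f : T -> T') : free2 T -> free2 T' :=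
  fglift (fun x : {classic T} => free2_gen (f x)).

Definition aug (T : Type) : free2 T -> 'F_2 :=
  fglift (fun _ : {classic T} => 1 : ('F_2)^o).

Lemma free2_mapB T T' (f : T -> T') : zmod_morphism (free2_map f).
Proof. exact: lift_is_additive. Qed.

Lemma augB T : zmod_morphism (@aug T).
Proof. exact: (lift_is_additive (fun _ : {classic T} => 1 : ('F_2)^o)). Qed.

Lemma free2_map_gen T T' (f : T -> T') x :
  free2_map f (free2_gen x) = free2_gen (f x).
Proof. by rewrite /free2_map liftU scale1r. Qed.

Lemma aug_gen T (x : T) : aug (free2_gen x) = 1.
Proof. by rewrite /aug liftU scale1r. Qed.

Lemma free2_ext T (V : zmodType) (f g : free2 T -> V) :
  zmod_morphism f -> zmod_morphism g ->
  (forall x, f (free2_gen x) = g (free2_gen x)) -> f =1 g.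
Proof.
move=> fB gB fg c; rewrite -(freeg_sumE c).
rewrite (big_morph f (zmorphD fB) (zmorph0 fB)).
rewrite (big_morph g (zmorphD gB) (zmorph0 gB)).
apply: eq_bigr => z _; case: (coeff z c) => -[|[|//]] hm.
- have -> : Ordinal hm = 0 :> 'F_2 by apply: val_inj.
  by rewrite freegU0 (zmorph0 fB) (zmorph0 gB).
- have -> : Ordinal hm = 1 :> 'F_2 by apply: val_inj.
  exact: fg.
Qed.

Section Homology.
Variable S : simplicial_gset.

(** [C_n = Z/2 (x) S_n]; the signs [(-1)^i] in the boundary disappear modulo 2. *)
Definition chains n := free2 (S n).

Definition boundary n (c : chains n.+1) : chains n :=
  \sum_(i < n.+2) free2_map (sg_map (coface i)) c.

Definition chain_act n (s : Gam) : chains n -> chains n := free2_map (sg_act s).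

Lemma boundaryB n : zmod_morphism (@boundary n).
Proof.
move=> x y; rewrite /boundary -sumrB; apply: eq_bigr => i _.
exact: free2_mapB.
Qed.

Lemma chain_actB n s : zmod_morphism (@chain_act n s).
Proof. exact: free2_mapB. Qed.

Lemma chain_act1 n c : @chain_act n 1%g c = c.
Proof.
apply: (free2_ext (g := id)) c => [|//|x]; first exact: chain_actB.
by rewrite /chain_act free2_map_gen sg_act1.
Qed.

Lemma chain_actM n s t c :
  @chain_act n (s * t)%g c = chain_act s (chain_act t c).
Proof.
apply: (free2_ext (g := @chain_act n s \o chain_act t)) c => [|x y|x].
- exact: chain_actB.
- by rewrite /= !chain_actB.
- by rewrite /chain_act /= !free2_map_gen sg_actM.
Qed.

Lemma chain_act_smooth n c : smooth (@chain_act n) c.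
Proof.
rewrite -(freeg_sumE c); elim: (dom c) => [|x r [xs hxs]].
  by exists [::] => s _; rewrite big_nil (zmorph0 (chain_actB s)).
have [ys hys] := sg_smooth x; exists (xs ++ ys) => s hs.
rewrite big_cons (zmorphD (chain_actB s)) hxs => [|u us]; last first.
  by apply: hs; rewrite mem_cat us.
congr (_ + _); rewrite /chain_act /free2_map liftU hys => [|u us]; last first.
  by apply: hs; rewrite mem_cat us orbT.
case: (coeff x c) => -[|[|//]] hm.
- have -> : Ordinal hm = 0 :> 'F_2 by apply: val_inj.
  by rewrite scale0r freegU0.
- have -> : Ordinal hm = 1 :> 'F_2 by apply: val_inj.
  by rewrite scale1r.
Qed.

Lemma boundary_act n s c :
  boundary (@chain_act n.+1 s c) = chain_act s (boundary c).
Proof.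
rewrite /boundary (big_morph _ (zmorphD (chain_actB s)) (zmorph0 (chain_actB s))).
apply: eq_bigr => i _.
apply: (free2_ext (f := free2_map _ \o chain_act s)
                  (g := chain_act s \o free2_map _)) c => [x y|x y|x] /=.
- by rewrite /chain_act !free2_mapB.
- by rewrite /chain_act !free2_mapB.
- by rewrite /chain_act !free2_map_gen sg_map_act.
Qed.

Lemma aug_act n s c : aug (@chain_act n s c) = aug c.
Proof.
apply: (free2_ext (f := @aug _ \o chain_act s)) c => [x y||x].
- by rewrite /= chain_actB augB.
- exact: augB.
- by rewrite /chain_act /= free2_map_gen !aug_gen.
Qed.

Lemma aug_boundary (c : chains 1) : aug (boundary c) = 0.
Proof.
apply: (free2_ext (f := @aug _ \o @boundary 0) (g := fun=> 0)) c => [x y|x y|x].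
- by rewrite /= boundaryB augB.
- by rewrite subrr.
- rewrite /boundary /= !big_ord_recl big_ord0 !free2_map_gen addr0.
  by rewrite (zmorphD (@augB _)) !aug_gen; apply: val_inj.
Qed.

(** The fibre [F] of [C -> Z/2] is [... -> C_1 -> C_0 -> Z/2], with [Z/2] in degree
    -1; so [H_0(C)] is [C_0 / B0] and [H_0(F)] is [Z0F / B0]. *)
Definition B0 : {pred chains 0} := fun c => `[< exists b, boundary b = c >].
Definition Z0F : {pred chains 0} := fun c => aug c == 0.

Fact B0_zmod : zmod_closed B0.
Proof.
split; first by apply/asboolP; exists 0; rewrite (zmorph0 (@boundaryB 0)).
move=> x y /asboolP[b <-] /asboolP[c <-]; apply/asboolP; exists (b - c).
by rewrite boundaryB.
Qed.
HB.instance Definition _ := GRing.isZmodClosed.Build _ B0 B0_zmod.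

Fact Z0F_zmod : zmod_closed Z0F.
Proof.
split; first by rewrite unfold_in (zmorph0 (@augB _)).
move=> x y; rewrite !unfold_in augB => /eqP-> /eqP->.
by rewrite subrr.
Qed.
HB.instance Definition _ := GRing.isZmodClosed.Build _ Z0F Z0F_zmod.

Record cycles0 := Cycle0 { cyc :> chains 0; _ : cyc \in Z0F }.
HB.instance Definition _ := [isSub for cyc].
HB.instance Definition _ := [Choice of cycles0 by <:].
HB.instance Definition _ := [SubChoice_isSubZmodule of cycles0 by <:].

Definition B0F : {pred cycles0} := fun c => cyc c \in B0.
Fact B0F_zmod : zmod_closed B0F.
Proof.
split; first exact: (rpred0 B0).
move=> x y; rewrite /in_mem /= => hx hy.
exact: (@rpredB _ B0 (cyc x) (cyc y) hx hy).
Qed.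
HB.instance Definition _ := GRing.isZmodClosed.Build _ B0F B0F_zmod.

End Homology.
End SimplicialGset.

Arguments B0 {K Ks iota} S.
Arguments Z0F {K Ks iota} S.
Arguments B0F {K Ks iota} S.

Section QuotientMap.
Variables (V W : zmodType) (I : zmodClosed V) (J : zmodClosed W) (f : V -> W).

Definition quot_map (x : Quotient.quot I) : Quotient.quot J :=
  \pi_(Quotient.quot J) (f (repr x)).

Hypotheses (fB : zmod_morphism f) (fIJ : forall x, x \in I -> f x \in J).

Lemma quot_map_pi x :
  quot_map (\pi_(Quotient.quot I) x) = \pi_(Quotient.quot J) (f x).
Proof.
apply/eqP; rewrite -Quotient.idealrBE -fB; apply: fIJ.
by rewrite Quotient.idealrBE reprK.
Qed.

Lemma quot_mapB : zmod_morphism quot_map.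
Proof.
move=> x y; rewrite -[x]reprK -[y]reprK.
rewrite -(raddfB \pi_(Quotient.quot I)) !quot_map_pi fB.
exact: (raddfB \pi_(Quotient.quot J)).
Qed.

End QuotientMap.

Section ReducedHomology.
Variables (K Ks : fieldType) (iota : {rmorphism K -> Ks}).
Local Notation Gam := (absGal iota).

Section Modules.
Variable S : simplicial_gset iota.
Local Notation HC := (Quotient.quot (B0 S)).
Local Notation HF := (Quotient.quot (B0F S)).

Lemma B0_act s (c : chains S 0) : c \in B0 S -> chain_act s c \in B0 S.
Proof.
move=> /asboolP[b <-]; apply/asboolP; exists (chain_act s b).
exact: boundary_act.
Qed.

Let H0C_act s : HC -> HC :=
  quot_map (B0 S) (chain_act s).

Fact H0C_act_pi s x : H0C_act s (\pi_HC x) = \pi_HC (chain_act s x).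
Proof. by apply: quot_map_pi; [exact: chain_actB | exact: B0_act]. Qed.

Fact H0C_actB s : zmod_morphism (H0C_act s).
Proof. by apply: quot_mapB; [exact: chain_actB | exact: B0_act]. Qed.

Fact H0C_act1 x : H0C_act 1%g x = x.
Proof. by rewrite -[x in LHS]reprK H0C_act_pi chain_act1 reprK. Qed.

Fact H0C_actM s t x : H0C_act (s * t)%g x = H0C_act s (H0C_act t x).
Proof. by rewrite -[x]reprK !H0C_act_pi chain_actM reprK. Qed.

Fact H0C_smooth x : smooth H0C_act x.
Proof.
have [xs hxs] := chain_act_smooth (repr x).
by exists xs => s hs; rewrite -[x in LHS]reprK H0C_act_pi hxs // reprK.
Qed.

(** [H_0(C)], which is also the truncation [P_{<= 0} C]. *)
Definition H0C : gmodule iota :=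
  GModule H0C_actB H0C_act1 H0C_actM H0C_smooth.

Definition cycle_act (s : Gam) (c : cycles0 S) : cycles0 S.
Proof.
exists (chain_act s c); rewrite unfold_in aug_act; exact: (valP c).
Defined.

Lemma cycle_actB s : zmod_morphism (cycle_act s).
Proof. by move=> x y; apply: val_inj; exact: chain_actB. Qed.

Lemma B0F_act s (c : cycles0 S) : c \in B0F S -> cycle_act s c \in B0F S.
Proof. exact: B0_act. Qed.

Let H0F_act s : HF -> HF :=
  quot_map (B0F S) (cycle_act s).

Fact H0F_act_pi s x : H0F_act s (\pi_HF x) = \pi_HF (cycle_act s x).
Proof. by apply: quot_map_pi; [exact: cycle_actB | exact: B0F_act]. Qed.

Fact H0F_actB s : zmod_morphism (H0F_act s).
Proof. by apply: quot_mapB; [exact: cycle_actB | exact: B0F_act]. Qed.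

Fact H0F_act1 x : H0F_act 1%g x = x.
Proof.
rewrite -[x in LHS]reprK H0F_act_pi -[RHS]reprK; congr (\pi_HF _).
by apply: val_inj; exact: chain_act1.
Qed.

Fact H0F_actM s t x : H0F_act (s * t)%g x = H0F_act s (H0F_act t x).
Proof.
rewrite -[x]reprK !H0F_act_pi reprK; congr (\pi_HF _).
by apply: val_inj; exact: chain_actM.
Qed.

Fact H0F_smooth x : smooth H0F_act x.
Proof.
have [xs hxs] := chain_act_smooth (cyc (repr x)).
exists xs => s hs; rewrite -[x in LHS]reprK H0F_act_pi -[RHS]reprK.
by congr (\pi_HF _); apply: val_inj; exact: hxs.
Qed.

Definition H0F : gmodule iota :=
  GModule H0F_actB H0F_act1 H0F_actM H0F_smooth.

Let incl : HF -> HC :=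
  quot_map (B0 S) (@cyc _ _ _ S).

Fact incl_pi x : incl (\pi_HF x) = \pi_HC (cyc x).
Proof. exact: quot_map_pi. Qed.

Fact inclB : zmod_morphism incl.
Proof. exact: quot_mapB. Qed.

Fact incl_act s x : incl (H0F_act s x) = H0C_act s (incl x).
Proof. by rewrite -[x]reprK H0F_act_pi !incl_pi H0C_act_pi. Qed.

Definition H0F_incl : gmodule_hom H0F H0C := @GModuleHom _ _ _ H0F H0C incl inclB incl_act.

Let aug0 (x : HC) : 'F_2 := aug (repr x).

Fact aug0_pi x : aug0 (\pi_HC x) = aug x.
Proof.
apply/eqP; rewrite -subr_eq0 -augB; apply/eqP.
have : repr (\pi_HC x) - x \in B0 S.
  by rewrite Quotient.idealrBE reprK.
by move=> /asboolP[b <-]; exact: aug_boundary.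
Qed.

Fact aug0B : zmod_morphism aug0.
Proof.
move=> x y; rewrite -[x]reprK -[y]reprK -(raddfB \pi_HC).
by rewrite !aug0_pi augB.
Qed.

Fact aug0_act s x : aug0 (H0C_act s x) = aug0 x.
Proof. by rewrite -[x]reprK H0C_act_pi !aug0_pi aug_act. Qed.

Definition H0C_aug : gmodule_hom H0C (gmodZ2 iota) :=
  @GModuleHom _ _ _ H0C (gmodZ2 iota) aug0 aug0B aug0_act.

End Modules.

Section Functoriality.
Variables (S T : simplicial_gset iota) (f : sgset_hom S T).

Definition chain_map n : chains S n -> chains T n := free2_map (sgh f (n := n)).

Lemma chain_mapB n : zmod_morphism (@chain_map n).
Proof. exact: free2_mapB. Qed.

Lemma aug_map (c : chains S 0) : aug (chain_map c) = aug c.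
Proof.
apply: (free2_ext (f := @aug _ \o @chain_map 0)) c => [x y||x].
- by rewrite /= chain_mapB augB.
- exact: augB.
- by rewrite /chain_map /= free2_map_gen !aug_gen.
Qed.

Lemma boundary_map n (c : chains S n.+1) :
  boundary (chain_map c) = chain_map (boundary c).
Proof.
rewrite /boundary (big_morph _ (zmorphD (@chain_mapB n)) (zmorph0 (@chain_mapB n))).
apply: eq_bigr => i _.
apply: (free2_ext (f := free2_map _ \o @chain_map n.+1)
                  (g := @chain_map n \o free2_map _)) c => [x y|x y|x] /=.
- by rewrite /chain_map !free2_mapB.
- by rewrite /chain_map !free2_mapB.
- by rewrite /chain_map !free2_map_gen sgh_map.
Qed.

Lemma chain_map_act n s (c : chains S n) :
  chain_map (chain_act s c) = chain_act s (chain_map c).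
Proof.
apply: (free2_ext (f := @chain_map n \o chain_act s)
                  (g := chain_act s \o @chain_map n)) c => [x y|x y|x] /=.
- by rewrite /chain_map /chain_act !free2_mapB.
- by rewrite /chain_map /chain_act !free2_mapB.
- by rewrite /chain_map /chain_act !free2_map_gen sgh_act.
Qed.

Definition cycle_map (c : cycles0 S) : cycles0 T.
Proof.
exists (chain_map c); rewrite unfold_in aug_map; exact: (valP c).
Defined.

Lemma cycle_mapB : zmod_morphism cycle_map.
Proof. by move=> x y; apply: val_inj; exact: chain_mapB. Qed.

Lemma B0F_map c : c \in B0F S -> cycle_map c \in B0F T.
Proof.
move=> /asboolP[b hb]; apply/asboolP; exists (chain_map b).
by rewrite boundary_map hb.
Qed.

Let H0map : Quotient.quot (B0F S) -> Quotient.quot (B0F T) :=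
  quot_map (B0F T) cycle_map.

Fact H0map_pi x : H0map (\pi_(Quotient.quot (B0F S)) x) =
  \pi_(Quotient.quot (B0F T)) (cycle_map x).
Proof. by apply: quot_map_pi; [exact: cycle_mapB | exact: B0F_map]. Qed.

Fact H0mapB : zmod_morphism H0map.
Proof. by apply: quot_mapB; [exact: cycle_mapB | exact: B0F_map]. Qed.

Fact H0map_act s (x : H0F S) : H0map (gact s x) = gact s (H0map x : H0F T).
Proof.
have -> : x = \pi_(Quotient.quot (B0F S)) (repr x) by rewrite reprK.
move: (repr x) => y; transitivity (H0map (\pi_(Quotient.quot (B0F S)) (cycle_act s y))).
  by congr H0map; exact: H0F_act_pi.
transitivity (gact s (\pi_(Quotient.quot (B0F T)) (cycle_map y) : H0F T)); last first.
  by rewrite H0map_pi.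
rewrite H0map_pi [RHS]H0F_act_pi; congr (\pi_(_) _).
by apply: val_inj; exact: chain_map_act.
Qed.

Definition H0F_map : gmodule_hom (H0F S) (H0F T) :=
  @GModuleHom _ _ _ (H0F S) (H0F T) H0map H0mapB H0map_act.

End Functoriality.
End ReducedHomology.

Section EtaleHomotopy.
Variables (K Ks : fieldType) (iota : {rmorphism K -> Ks}) (a : K).

Definition emb_comp (L M : fieldExtType K) (f : embedding iota L) (g : 'AHom(M, L)) :
  embedding iota M.
Proof.
exists (f \o g) => [x y|//|c] /=; first by rewrite raddfB emb_zmod.
  split=> [|x y] /=; first by rewrite rmorph1 (emb_monoid f).1.
  by rewrite rmorphM (emb_monoid f).2.
by rewrite linearZ /= rmorph1 emb_scalar.
Defined.

Definition pi0_map (V U : etaleX a) (h : homX V U)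
    (x : pi0 (base_change iota V)) : pi0 (base_change iota U) :=
  existT _ (hpt h (projT1 x)) (emb_comp (projT2 x) (hfld h (projT1 x))).

Lemma pi0_map_id (U : etaleX a) x : pi0_map (idX U) x = x.
Proof.
by case: x => i f; congr existT; apply: emb_eqP => z; rewrite /= id_lfunE.
Qed.

Lemma pi0_map_comp (W V U : etaleX a) (f : homX V U) (g : homX W V) x :
  pi0_map (compX f g) x = pi0_map f (pi0_map g x).
Proof.
by case: x => i e; congr existT; apply: emb_eqP => z; rewrite /= comp_lfunE.
Qed.

Lemma pi0_map_act (V U : etaleX a) (h : homX V U) s x :
  pi0_map h (pi0_act s x) = pi0_act s (pi0_map h x).
Proof. by case: x => i e; congr existT; apply: emb_eqP. Qed.

(** The simplicial [Gam]-set [pi_0] of the base change of [U_.]; for [U] running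
    over the hypercoverings of [X] these form the relative étale homotopy type. *)
Definition Et (U : simplicialX a) : simplicial_gset iota.
Proof.
refine (@SimplicialGset K Ks iota (fun n => pi0 (base_change iota (U n)))
  (fun m n f => pi0_map (sx_map U f)) (fun n s => @pi0_act K Ks iota (U n) s)
  _ _ _ _ _ _).
- by move=> n x; rewrite sx_id pi0_map_id.
- by move=> l m n f g x; rewrite sx_comp pi0_map_comp.
- by move=> n x; exact: pi0_act1.
- by move=> n s t x; exact: pi0_actM.
- by move=> n x; exact: pi0_act_smooth.
- by move=> m n f s x; exact: pi0_map_act.
Defined.

Definition Et_map (V U : hypercovering a) (h : hc_hom V U) :
  sgset_hom (Et V) (Et U).
Proof.
exists (fun n => pi0_map (hch h n)) => [m n f x|n s x].
- by rewrite -[LHS]pi0_map_comp hch_natural pi0_map_comp.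
- exact: pi0_map_act.
Defined.

(** The pro-[Gam]-module [H_0(F)]. *)
Definition proH0F (U : hypercovering a) : gmodule iota := H0F (Et U).
Definition proH0F_map (V U : hypercovering a) (h : hc_hom V U) :
  gmodule_hom (proH0F V) (proH0F U) := H0F_map (Et_map h).

(** [H_{-1}(F)], the cokernel of [C_0 -> Z/2], vanishes. *)
Definition reduced_homology_vanishes_below0 :=
  forall (U : hypercovering a) (e : 'F_2), exists c : chains (Et U) 0, aug c = e.

(** Elements of [H^1(Gam, H_0(F))], i.e. of the limit of the groups
    [H^1(Gam, H_0(F_U))] over all hypercoverings [U]. *)
Record H1_proH0F := H1Pro {
  h1p :> forall U : hypercovering a, H1 (proH0F U);
  h1p_compat : forall V U (h : hc_hom V U), H1_map (proH0F_map h) (h1p V) = h1p U }.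

(** [o] is the first obstruction: the image of [1] under the connecting map of
    [H_0(F) -> P_{<= 0} C -> Z/2]. *)
Definition is_first_obstruction (o : H1_proH0F) :=
  forall U : hypercovering a,
    connecting (H0F_incl (Et U)) (H0C_aug (Et U)) 1 (o U).

(** Isomorphisms of pro-[Gam]-modules from the constant [Z/2] to [H_0(F)]. *)
Record iso_Z2_proH0F := IsoZ2 {
  isoZ2 :> forall U : hypercovering a, gmodule_hom (gmodZ2 iota) (proH0F U);
  isoZ2_bij : forall U, bijective (isoZ2 U);
  isoZ2_natural : forall V U (h : hc_hom V U) e,
    proH0F_map h (isoZ2 V e) = isoZ2 U e }.

Lemma cocycle_map_cohomologous (M N : gmodule iota) (phi : gmodule_hom M N) z w :
  cohomologous z w -> cohomologous (cocycle_map phi z) (cocycle_map phi w).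
Proof.
move=> /asboolP[m hm]; apply/asboolP; exists (phi m) => s /=.
by rewrite -(gmhB phi) hm (gmhB phi) gmh_act.
Qed.

Lemma H1_map_pi (M N : gmodule iota) (phi : gmodule_hom M N) z :
  H1_map phi (\pi_(H1 M) z) = \pi_(H1 N) (cocycle_map phi z).
Proof.
apply/eqP; rewrite eqquotE; apply: cocycle_map_cohomologous.
by rewrite -(eqquotE (H1 M)) reprK.
Qed.

Definition iso_H1 (psi : iso_Z2_proH0F) (c : H1 (gmodZ2 iota)) : H1_proH0F.
Proof.
exists (fun U => H1_map (psi U) c) => V U h.
rewrite -[c]reprK !H1_map_pi reprK; apply/eqP; rewrite eqquotE; apply/asboolP.
exists 0 => s; rewrite (zmorph0 (gactB s)) subrr; apply/eqP.
by rewrite subr_eq0; apply/eqP; exact: isoZ2_natural.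
Defined.

End EtaleHomotopy.

Section Kummer.
Variables (K Ks : fieldType) (iota : {rmorphism K -> Ks}).
Hypotheses (iotaP : is_separable_closure iota) (charK : 2 \notin [pchar K]).

Lemma two_neq0 : 2 != 0 :> Ks.
Proof.
by have := charK; rewrite inE /= -(fmorph_eq0 iota) rmorph_nat.
Qed.

Lemma sqrt_exists (a : K) : a != 0 -> exists r : Ks, r ^+ 2 = iota a.
Proof.
move=> a0; pose p : {poly Ks} := 'X^2 - (iota a)%:P.
have sp : size p = 3 by rewrite size_XnsubC.
have [||r] := iotaP.2 p; last first.
- by rewrite rootE !hornerE subr_eq0 => /eqP <-; exists r.
- by rewrite sp.
rewrite separable_poly.unlock derivB derivC subr0 derivXn /= expr1 -scaler_nat.
rewrite coprimepZr ?two_neq0 // coprimepX.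
by rewrite rootE !hornerE expr0n /= sub0r oppr_eq0 fmorph_eq0.
Qed.

Variables (a : K) (a0 : a != 0).

Definition sqrt_a : Ks := sval (cid (sqrt_exists a0)).

Lemma sqrt_aP : sqrt_a ^+ 2 = iota a.
Proof. by rewrite /sqrt_a; case: cid. Qed.

(** The character [chi] with [s (sqrt a) = (-1)^(chi s) * sqrt a]. *)
Definition kummer_fun (s : absGal iota) : 'F_2 := (s sqrt_a != sqrt_a)%:R.

Lemma kummer_sign (s : absGal iota) : s sqrt_a = (-1) ^+ kummer_fun s * sqrt_a.
Proof.
have : s sqrt_a ^+ 2 = sqrt_a ^+ 2.
  by rewrite expr2 -(gal_monoid s).2 -expr2 sqrt_aP gal_fix.
rewrite /kummer_fun => /eqP; rewrite eqf_sqr.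
case: eqP => [-> _ | _ /eqP ->]; first by rewrite mul1r.
by rewrite mulN1r.
Qed.

Definition kummer_cocycle : cocycle (gmodZ2 iota).
Proof.
exists kummer_fun => [s|s t].
  by exists [:: sqrt_a] => t h; rewrite /kummer_fun h ?mem_head.
have r0 : sqrt_a != 0.
  by have := a0; rewrite -(fmorph_eq0 iota) -sqrt_aP sqrf_eq0.
have N : (- sqrt_a == sqrt_a) = false.
  by rewrite eq_sym -addr_eq0 -mulr2n -mulr_natl mulf_eq0
     (negbTE two_neq0) (negbTE r0).
have sq (u : absGal iota) : u sqrt_a = sqrt_a \/ u sqrt_a = - sqrt_a.
  rewrite kummer_sign /kummer_fun; case: (_ == _) => /=.
    by left; rewrite mul1r.
  by right; rewrite mulN1r.
rewrite /kummer_fun /=; case: (sq t) => ->; case: (sq s) => es;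
  rewrite ?(zmorphN (gal_zmod s)) ?es ?opprK ?eqxx ?N ?eqxx;
  exact: val_inj.
Defined.

Definition kummer_class : H1 (gmodZ2 iota) := \pi_(H1 (gmodZ2 iota)) kummer_cocycle.

End Kummer.

(* Main.v *)
(** Since [X] is étale with two geometric points [1/sqrt a] and [-1/sqrt a], every
    hypercovering [U] of [X] has exactly two classes of 0-simplices of
    [pi_0] modulo 1-simplices, told apart by the value of the coordinate: the
    covering condition in degree 0 makes both values occur, and the one in
    degree 1 joins any two 0-simplices of equal value. Hence [H_0(C)] is free on
    these two classes, and a 0-chain is determined modulo boundaries by its
    augmentation and by the number [omega] modulo 2 of its points over
    [1/sqrt a]. On [H_0(F)] the map [omega] is an isomorphism onto [Z/2]. For a
    chain [m] of augmentation 1 one has [omega (s m - m) = 1] exactly when [s]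
    exchanges the two points, that is when [s] moves [sqrt a]; so the connecting
    cocycle is the Kummer character whatever the lift [m]. *)
From HB Require Import structures.
Require Import Defs.
From mathcomp Require Import all_boot all_algebra all_field.
From mathcomp Require Import boolp freeg.

Set Implicit Arguments.
Unset Strict Implicit.
Unset Printing Implicit Defensive.

Import GRing.Theory.
Local Open Scope ring_scope.
Local Open Scope quotient_scope.

(** * Finite extensions of $K$ inside an extension field *)

Section Embeddings.
Variables (K E : fieldType) (j : {rmorphism K -> E}).

Definition emb_rmorphism (L : fieldExtType K) (f : embedding j L) :
    {rmorphism L -> E} :=
  HB.pack (emb f) (GRing.isZmodMorphism.Build _ _ _ (emb_zmod f))
                  (GRing.isMonoidMorphism.Build _ _ _ (emb_monoid f)).

Lemma emb_inj (L : fieldExtType K) (f : embedding j L) : injective f.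
Proof. exact: (fmorph_inj (emb_rmorphism f)). Qed.

Lemma embZ (L : fieldExtType K) (f : embedding j L) c x : f (c *: x) = j c * f x.
Proof. by rewrite -mulr_algl (emb_monoid f).2 emb_scalar. Qed.

Definition regular_embedding : embedding j (K^o : fieldExtType K).
Proof.
exists (j : K^o -> E) => [|| c]; first exact: rmorphB.
  by split=> [|x y]; rewrite ?rmorph1 ?rmorphM.
by rewrite /GRing.scale /= mulr1.
Defined.

(** An irreducible polynomial of [x] is one of least size among those vanishing at [x]. *)
Lemma irreducible_annihilator (x : E) (p : {poly K}) :
  p != 0 -> root (map_poly j p) x ->
  exists2 q, irreducible_poly q & root (map_poly j q) x.
Proof.
have [n] := ubnP (size p); elim: n p => // n IH p; rewrite ltnS => le_pn p0 px.
have [[q [qx q0 lt_qp]] | min_p] :=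
  pselect (exists q, [/\ root (map_poly j q) x, q != 0 & (size q < size p)%N]).
  by apply: IH qx => //; apply: leq_trans lt_qp le_pn.
exists p => //; apply/(subfx_irreducibleP px p0) => q qx q0.
by rewrite leqNgt; apply/negP => lt_qp; apply: min_p; exists q.
Qed.

(** The field is $K[T]/(q)$ for an irreducible [q] with root [x], and [subfx_inj] is evaluation at
    [x]. *)
Lemma simple_extension (x : E) (p : {poly K}) :
  p != 0 -> root (map_poly j p) x ->
  exists (L : fieldExtType K) (e : embedding j L), exists z, e z = x.
Proof.
move=> /irreducible_annihilator /[apply] -[q irr_q qx].
have q0 := irredp_neq0 irr_q.
have eZ c : subfx_inj (c%:A : SubFieldExtType qx irr_q) = j c.
  exact: subfx_inj_base.
have eB : zmod_morphism (subfx_inj : SubFieldExtType qx irr_q -> E).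
  exact: subfx_inj_is_zmod_morphism.
have eM : monoid_morphism (subfx_inj : SubFieldExtType qx irr_q -> E).
  exact: subfx_inj_is_monoid_morphism.
exists (SubFieldExtType qx irr_q), (Embedding eB eM eZ), (subfx_root j x q).
exact: subfx_inj_root.
Qed.

End Embeddings.

Lemma finite_extension (K E : fieldType) (j : {rmorphism K -> E}) (xs : seq E) :
  (forall x, x \in xs -> exists2 p : {poly K}, p != 0 & root (map_poly j p) x) ->
  exists (L : fieldExtType K) (e : embedding j L),
    forall x, x \in xs -> exists z, e z = x.
Proof.
elim: xs => [_|x xs IH alg_xs]; first by exists K^o, (regular_embedding j).
have [y yxs|L [e eL]] := IH; first by apply: alg_xs; rewrite inE yxs orbT.
have [p p0 px] := alg_xs x (mem_head _ _).
(* The next element is adjoined over [L], with [E] an extension of [L] through [e]; scalars are then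
   restricted to $K$ by [baseFieldType]. *)
have [||M [f [z fz]]] := @simple_extension L E (emb_rmorphism e) x (map_poly (in_alg L) p).
- by rewrite map_poly_eq0.
- rewrite -map_poly_comp; congr (root _ x): px.
  by apply: eq_map_poly => c /=; rewrite emb_scalar.
have fZ c : f (c%:A : baseFieldType M) = j c.
  by rewrite baseField_scaleE emb_scalar [LHS]emb_scalar.
exists (baseFieldType M).
exists (@Embedding _ _ j (baseFieldType M) f (emb_zmod f) (emb_monoid f) fZ) => y.
rewrite inE => /orP[/eqP-> | /eL[u <-]]; first by exists z.
by exists (u%:A : M); rewrite /= emb_scalar.
Qed.

Section LiftEmbedding.
Variables (K E : fieldType) (j : {rmorphism K -> E}) (L M : fieldExtType K).
Variables (f : embedding j L) (e : embedding j M).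

(** By $K$-linearity the whole image of [f] lies in that of [e]; injectivity of [e] then makes the
    choice of preimages an algebra morphism. *)
Lemma lift_embedding : (forall i, exists z, e z = f (tnth (vbasis {:L}) i)) ->
  exists g : 'AHom(L, M), forall x, e (g x) = f x.
Proof.
move=> /choice[w ew].
have sumE (N : fieldExtType K) (h : embedding j N) n (u : 'I_n -> N) :
    h (\sum_i u i) = \sum_i h (u i).
  exact: (rmorph_sum (emb_rmorphism h)).
have ex x : exists y, e y = f x.
  exists (\sum_i coord (vbasis {:L}) i x *: w i).
  rewrite sumE [in RHS](coord_vbasis (memvf x)) sumE; apply: eq_bigr => i _.
  by rewrite !embZ ew (tnth_nth 0).
have [g eg] := choice ex.
have gB : zmod_morphism g.
  by move=> x y; apply: (@emb_inj _ _ _ _ e); rewrite (emb_zmod e) !eg (emb_zmod f).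
have gM : monoid_morphism g.
  split=> [|x y]; apply: (@emb_inj _ _ _ _ e).
    by rewrite eg (emb_monoid e).1 (emb_monoid f).1.
  by rewrite (emb_monoid e).2 !eg (emb_monoid f).2.
have gZ : scalable g.
  by move=> c x; apply: (@emb_inj _ _ _ _ e); rewrite eg !embZ eg.
pose g' : {lrmorphism L -> M} := HB.pack g (GRing.isZmodMorphism.Build _ _ _ gB)
  (GRing.isMonoidMorphism.Build _ _ _ gM) (GRing.isScalable.Build _ _ _ _ _ gZ).
by exists (linfun_ahom g') => x; rewrite lfunE /= eg.
Qed.

End LiftEmbedding.

(** * Embeddings into the separable closure *)

Section SeparableClosure.
Variables (K Ks : fieldType) (iota : {rmorphism K -> Ks}).
Hypothesis iotaP : is_separable_closure iota.

Lemma embedding_separable (L : fieldExtType K) (e : embedding iota L) :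
  separable 1%AS {:L}.
Proof.
apply/separableP => y _; have [p sp pey] := iotaP.1 (e y).
apply/separable_elementP; exists (map_poly (in_alg L) p); split.
- by apply/polyOver1P; exists p.
- rewrite -(fmorph_root (emb_rmorphism e)) -map_poly_comp.
  congr (root _ _): pey; apply: eq_map_poly => c /=; by rewrite emb_scalar.
- by rewrite separable_map.
Qed.

Lemma finite_subextension (xs : seq Ks) :
  exists (L : fieldExtType K) (e : embedding iota L),
    forall x, x \in xs -> exists z, e z = x.
Proof.
apply: finite_extension => x _; have [p sp px] := iotaP.1 x.
by exists p => //; exact: separable_poly_neq0.
Qed.

(** With [M = L(z)], map [P(z)] to [P(w)], where [w] is a root in [Ks] of the
    image of the minimal polynomial of [z] over [L]. *)
Lemma extend_embedding (L M : fieldExtType K) (h : 'AHom(L, M)) (e : embedding iota L) :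
  separable 1%AS {:M} -> exists f : embedding iota M, forall x, f (h x) = e x.
Proof.
move=> sepM; pose H : {subfield M} := limg h.
have hH x : h x \in H by rewrite memv_img ?memvf.
have Hh u : u \in H -> exists x, h x = u by move=> /memv_imgP[x _ ->]; exists x.
have polyH (P : {poly M}) : P \is a polyOver H -> exists Q : {poly L}, map_poly h Q = P.
  move=> /polyOverP HP; have [c hc] := choice (fun i => Hh _ (HP i)).
  exists (\poly_(i < size P) c i); apply/polyP => i; rewrite coef_map coef_poly /=.
  by case: ltnP => [_ | ?]; rewrite ?hc // rmorph0 nth_default.
have sepHM : separable H {:M} by apply: separableSl sepM; exact: sub1v.
pose z := separable_generator H {:M}.
have defM : {:M}%VS = <<H; z>>%VS.
  exact: eq_adjoin_separable_generator (subvf _).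
have [m hm] := polyH _ (minPolyOver H z).
pose e' := emb_rmorphism e.
have sep_m : separable_poly m.
  by rewrite -(separable_map h) hm; exact: separable_generatorP.
have [w mw] : exists w, root (map_poly e' m) w.
  apply: iotaP.2; first by rewrite separable_map.
  rewrite size_map_poly -(size_map_poly h) hm gtn_eqF //.
  by rewrite (root_size_gt1 _ (root_minPoly H z)) ?monic_neq0 ?monic_minPoly.
have ev u : exists P : {poly L}, (map_poly h P).[z] = u.
  have : u \in <<H; z>>%VS by rewrite -defM memvf.
  by move=> /Fadjoin_polyP[P /polyH[Q <-] ->]; exists Q.
(* The minimal polynomial of [z] divides every polynomial vanishing at [z], and its image kills [w];
   hence $P(w)$ depends only on $P(z)$. *)
have ev0 (P : {poly L}) : (map_poly h P).[z] = 0 -> (map_poly e' P).[w] = 0.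
  move=> Pz; apply/eqP; apply: root_dvdp mw.
  rewrite dvdp_map -(dvdp_map h) hm; apply: minPoly_dvdp; last by apply/eqP.
  by apply/polyOverP => i; rewrite coef_map hH.
have evE (P Q : {poly L}) : (map_poly h P).[z] = (map_poly h Q).[z] ->
    (map_poly e' P).[w] = (map_poly e' Q).[w].
  move=> PQ; apply/eqP; rewrite -subr_eq0 -hornerN -hornerD -!rmorphB; apply/eqP.
  by apply: ev0; rewrite rmorphB hornerD hornerN PQ subrr.
have [P Pz] := choice ev; pose f u := (map_poly e' (P u)).[w].
have fB : zmod_morphism f.
  move=> u v; rewrite /f -hornerN -hornerD -!rmorphB; apply: evE.
  by rewrite rmorphB hornerD hornerN !Pz.
have fh x : f (h x) = e x.
  rewrite -[RHS](hornerC _ w) -(map_polyC e'); apply: evE.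
  by rewrite Pz map_polyC hornerC.
have fM : monoid_morphism f.
  split=> [|u v]; first by rewrite -(rmorph1 h) fh (emb_monoid e).1.
  by rewrite /f -hornerM -rmorphM; apply: evE; rewrite rmorphM hornerM !Pz.
have fZ c : f c%:A = iota c.
  by rewrite -(emb_scalar e c) -fh linearZ rmorph1.
by exists (Embedding fB fM fZ).
Qed.

End SeparableClosure.

(** * Geometric points of étale $X$-schemes and hypercoverings *)

Section EtaleSchemes.
Variables (K Ks : fieldType) (iota : {rmorphism K -> Ks}) (a : K).
Hypothesis iotaP : is_separable_closure iota.

Definition xcoord (U : etaleX a) (x : pi0 (base_change iota U)) : Ks :=
  projT2 x (pt_coord (projT1 x)).

Lemma xcoordP (U : etaleX a) (x : pi0 (base_change iota U)) : iota a * xcoord x ^+ 2 = 1.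
Proof.
case: x => i f; rewrite /xcoord /= -(emb_scalar f) !expr2 -!(emb_monoid f).2.
by rewrite -expr2 (pt_coordP i) (emb_monoid f).1.
Qed.

Lemma xcoord_map (V U : etaleX a) (h : homX V U) (x : pi0 (base_change iota V)) :
  xcoord (pi0_map h x) = xcoord x.
Proof. by case: x => i f; rewrite /xcoord /= hover. Qed.

Lemma xcoord_act (U : etaleX a) s (x : pi0 (base_change iota U)) :
  xcoord (pi0_act s x) = s (xcoord x).
Proof. by []. Qed.

(** An embedding of the residue field at a point extends to the residue field, finite and separable
    over it, at any preimage. *)
Lemma pi0_map_surj (V U : etaleX a) (h : homX V U) : surjectiveX h ->
  forall x : pi0 (base_change iota U), exists y, pi0_map h y = x.
Proof.
move=> h_surj [i f]; have [k hk] := h_surj i; subst i.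
have [g hg] := extend_embedding iotaP (hfld h k) f (fld_sep k).
by exists (existT _ k g); congr existT; apply: emb_eqP.
Qed.

(** The type of [hfld f i] depends on [hpt f i], so the two are compared together as a dependent
    pair. *)
Lemma homX_eqP (V U : etaleX a) (f g : homX V U) :
  (forall i, existT (fun k => 'AHom(fld k, fld i)) (hpt f i) (hfld f i) =
             existT (fun k => 'AHom(fld k, fld i)) (hpt g i) (hfld g i)) -> f = g.
Proof.
case: f g => f1 f2 f3 [g1 g2 g3] /= e.
have e1 : f1 = g1 by apply: funext => i; exact: (congr1 (@projT1 _ _) (e i)).
subst g1; have e2 : f2 = g2.
  apply: functional_extensionality_dep => i.
  move: (projT2_eq (e i)); by rewrite (Prop_irrelevance (projT1_eq (e i)) erefl).
by subst g2; congr HomX; exact: Prop_irrelevance.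
Qed.

Lemma comp_idX (V U : etaleX a) (f : homX V U) : compX (idX U) f = f.
Proof.
apply: homX_eqP => i /=; congr existT; apply: val_inj.
by apply/lfunP => x; rewrite comp_lfunE id_lfunE.
Qed.

Section Point.
Variables (L : fieldExtType K) (e : embedding iota L) (z : L).
Hypothesis zP : X_point a z.

Definition etale_point : etale K :=
  @Etale K unit (fun=> L) (fun=> embedding_separable iotaP e).

Definition pointX : etaleX a := @EtaleX K a etale_point (fun=> z) (fun=> zP).

Definition hom_pointX (U : etaleX a) (i : pts U) (g : 'AHom(fld i, L)) (gz : g (pt_coord i) = z) :
  homX pointX U := @HomX K a pointX U (fun=> i) (fun=> g) (fun=> gz).

End Point.

Section Simplicial.
Variable U : hypercovering a.

Fact cosk0_compat (T : etaleX a) l m (hl : (l < 0)%N) (hm : (m < 0)%N)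
    (f : Simplex m 0) (g : Simplex l m) :
  False_rect (homX T (U l)) (notF hl) = compX (sx_map U g) (False_rect _ (notF hm)).
Proof. by []. Qed.

Definition cosk0_point (T : etaleX a) : cosk_point U 0 T := CoskPoint (@cosk0_compat T).

(** The value [y] lies in a finite $L$, so $\mathrm{Spec}\,L$ is an étale $X$-scheme; a covering of
    it maps to [U 0], and a geometric point of the covering above [e] keeps the coordinate [y]. *)
Lemma xcoord_surj y : iota a * y ^+ 2 = 1 ->
  exists x : pi0 (base_change iota (U 0)), xcoord x = y.
Proof.
move=> yP; have [L [e eL]] := finite_subextension iotaP [:: y].
have [z ez] := eL y (mem_head _ _).
have zP : X_point a z.
  apply: (@emb_inj _ _ _ _ e).
  by rewrite (emb_monoid e).2 expr2 (emb_monoid e).2 emb_scalar (emb_monoid e).1 ez.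
have [T' [p [s [p_surj _]]]] := hc_covering (cosk0_point (pointX e zP)).
have [t pt] := pi0_map_surj p_surj (existT _ tt e).
exists (pi0_map s t); by rewrite xcoord_map -(xcoord_map p) pt.
Qed.

(** A pair of maps to [U 0] seen as a point of the coskeleton in degree 1: [u true] sits at the
    vertex 0 and [u false] at the vertex 1. *)
Definition cosk1_val (T : etaleX a) (u : bool -> homX T (U 0)) m : (m < 1)%N -> Simplex m 1 ->
  homX T (U m) :=
  match m with
  | 0 => fun _ f => u (val f ord0 == ord0)
  | _.+1 => fun hm => False_rect _ (notF hm)
  end.

Fact cosk1_compat (T : etaleX a) u l m (hl : (l < 1)%N) (hm : (m < 1)%N)
    (f : Simplex m 1) (g : Simplex l m) :
  cosk1_val u hl (simp_comp f g) = compX (sx_map U g) (@cosk1_val T u m hm f).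
Proof.
case: m hm f g => // hm f; case: l hl => // hl g.
have -> : g = simp_id 0.
  by apply: val_inj; apply/ffunP => i; rewrite [LHS]ord1 [RHS]ord1.
by rewrite sx_id comp_idX /= !ffunE.
Qed.

Definition cosk1_point (T : etaleX a) u : cosk_point U 1 T := CoskPoint (@cosk1_compat T u).

(** The 1-simplices of [U] cover [U_0 x_X U_0], whose geometric points are the
    pairs with equal coordinates. *)
Lemma xcoord_connected (x0 x1 : pi0 (base_change iota (U 0))) : xcoord x0 = xcoord x1 ->
  exists y : pi0 (base_change iota (U 1)),
    pi0_map (sx_map U (coface ord0)) y = x0 /\
    pi0_map (sx_map U (coface ord_max)) y = x1.
Proof.
case: x0 x1 => [i0 f0] [i1 f1] eq_coord.
(* Both residue fields embed in this $L$, so both points are defined over $\mathrm{Spec}\,L$. *)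
have [L [e eL]] := finite_subextension iotaP
  ([seq f0 b | b <- vbasis {: fld i0}] ++ [seq f1 b | b <- vbasis {: fld i1}]).
have [|g0 eg0] := lift_embedding (f := f0) (e := e).
  by move=> k; apply: eL; rewrite mem_cat map_f // mem_tnth.
have [|g1 eg1] := lift_embedding (f := f1) (e := e).
  by move=> k; apply: eL; rewrite mem_cat orbC map_f // mem_tnth.
have zP : X_point a (g0 (pt_coord i0)).
  have ga : g0 a%:A = a%:A by rewrite linearZ rmorph1.
  by rewrite /X_point -ga -rmorphXn -rmorphM (pt_coordP i0) rmorph1.
have g1z : g1 (pt_coord i1) = g0 (pt_coord i0).
  by apply: (@emb_inj _ _ _ _ e); rewrite eg0 eg1.
(* [coface ord0] hits the vertex 1, which [cosk1_val] sends to [u false]; so [u false] has to be the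
   map giving [x0]. *)
pose u (b : bool) : homX (pointX e zP) (U 0) :=
  if b then hom_pointX e zP g1z else hom_pointX e zP (erefl (g0 (pt_coord i0))).
have [T' [p [s [p_surj sP]]]] := hc_covering (cosk1_point u).
have [t pt] := pi0_map_surj p_surj (existT _ tt e).
exists (pi0_map s t); rewrite -!pi0_map_comp !(sP 0) //= !ffunE /= !pi0_map_comp pt.
by split; congr existT; apply: emb_eqP.
Qed.

End Simplicial.
End EtaleSchemes.

Lemma F2_cases (e : 'F_2) : e = 0 \/ e = 1.
Proof. by case: e => -[|[|//]] h; [left | right]; apply: val_inj. Qed.

(** * Galois action on the two geometric points of $X$ *)

Section HomologyOfX.
Variables (K Ks : fieldType) (iota : {rmorphism K -> Ks}).
Hypotheses (iotaP : is_separable_closure iota) (charK : 2 \notin [pchar K]).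
Variables (a : K) (a0 : a != 0).

Local Notation chi := (kummer_fun iotaP charK a0).
Local Notation sqrta := (sqrt_a iotaP charK a0).
Local Notation r := (sqrta^-1).

Lemma sqrt_a_neq0 : sqrta != 0.
Proof. by rewrite -sqrf_eq0 sqrt_aP fmorph_eq0. Qed.

Lemma root_rP : iota a * r ^+ 2 = 1.
Proof. by rewrite exprVn sqrt_aP divff // fmorph_eq0. Qed.

Lemma root_cases y : iota a * y ^+ 2 = 1 -> y = r \/ y = - r.
Proof.
rewrite -root_rP => /(mulfI _); rewrite fmorph_eq0 => /(_ a0) /eqP.
by rewrite eqf_sqr => /orP[/eqP-> | /eqP->]; [left | right].
Qed.

Lemma oppr_r_neq : (- r == r) = false.
Proof.
rewrite eq_sym -addr_eq0 -mulr2n -mulr_natl mulf_eq0 invr_eq0.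
by rewrite (negbTE (two_neq0 iota charK)) (negbTE sqrt_a_neq0).
Qed.

(** The sign by which [s] acts on the square root is its own inverse, so it is also the sign on
    [r]. *)
Lemma gal_r (s : absGal iota) : s r = (-1) ^+ chi s * r.
Proof.
have sr : s sqrta * s r = 1.
  by rewrite -(gal_monoid s).2 divff ?sqrt_a_neq0 // (gal_monoid s).1.
have s0 : s sqrta != 0.
  by apply: contraTneq isT => s0; move: sr; rewrite s0 mul0r => /eqP; rewrite eq_sym oner_eq0.
apply: (mulfI s0); rewrite sr kummer_sign mulrACA -expr2 sqrr_sign mul1r.
by rewrite divff ?sqrt_a_neq0.
Qed.

Lemma gal_root_eq (s : absGal iota) y : iota a * y ^+ 2 = 1 ->
  (s y == r)%:R = (y == r)%:R + chi s.
Proof.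
move=> /root_cases[] ->; rewrite ?(zmorphN (gal_zmod s)) gal_r;
  by case: (F2_cases (chi s)) => ->;
    rewrite /= ?mul1r ?mulN1r ?opprK ?eqxx ?oppr_r_neq; apply: val_inj.
Qed.

(** * $H_0$ of a single hypercovering *)

Section Hypercovering.
Variable U : hypercovering a.
Local Notation S := (Et iota U).
Local Notation HC := (Quotient.quot (B0 S)).
Local Notation HF := (Quotient.quot (B0F S)).

(** The number modulo 2 of points of a chain that lie over [r]. *)
Definition omega : chains S 0 -> 'F_2 :=
  fglift (fun x : {classic S 0} => (xcoord (x : pi0 (base_change iota (U 0))) == r)%:R
            : ('F_2)^o).

Lemma omegaB : zmod_morphism omega.
Proof.
exact: (lift_is_additive (fun x : {classic S 0} =>
  (xcoord (x : pi0 (base_change iota (U 0))) == r)%:R : ('F_2)^o)).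
Qed.

Lemma omega_gen (x : S 0) : omega (free2_gen x) = (xcoord x == r)%:R.
Proof. by rewrite /omega liftU scale1r. Qed.

(** A single point enters or leaves the fibre over [r] exactly when [chi s] is 1; by additivity a
    chain collects [chi s] once per point. *)
Lemma omega_act s (c : chains S 0) :
  omega (chain_act s c) = omega c + chi s * aug c.
Proof.
apply: (free2_ext (f := omega \o chain_act s)
                  (g := fun c => omega c + chi s * aug c)) c => [x y|x y|x] /=.
- by rewrite chain_actB omegaB.
- by rewrite omegaB augB mulrBr opprD addrACA.
- rewrite /chain_act free2_map_gen !omega_gen aug_gen mulr1.
  by rewrite xcoord_act gal_root_eq // xcoordP.
Qed.

Lemma boundary_gen (y : S 1) : boundary (free2_gen y) =
  free2_gen (sg_map (coface ord0) y) - free2_gen (sg_map (coface ord_max) y).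
Proof.
rewrite /boundary big_ord_recl big_ord1 !free2_map_gen -[- _]scaleN1r.
have -> : -1 = 1 :> 'F_2 by apply: val_inj.
by rewrite scale1r (_ : fintype.lift _ _ = ord_max) //; apply: val_inj.
Qed.

(** Face maps are morphisms over $X$, so both faces of a 1-simplex have the same coordinate. *)
Lemma omega_boundary (b : chains S 1) : omega (boundary b) = 0.
Proof.
apply: (free2_ext (f := omega \o @boundary _ _ _ S 0) (g := fun=> 0)) b => [x y|x y|y] /=.
- by rewrite boundaryB omegaB.
- by rewrite subrr.
- by rewrite boundary_gen omegaB !omega_gen /= !xcoord_map subrr.
Qed.

Lemma gen_B0 (x y : S 0) : xcoord x = xcoord y -> free2_gen x - free2_gen y \in B0 S.
Proof.
move=> /(xcoord_connected iotaP)[z [<- <-]].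
by apply/asboolP; exists (free2_gen z); exact: boundary_gen.
Qed.

Lemma xcoord_r : exists x : S 0, xcoord x = r.
Proof. exact: (xcoord_surj iotaP U root_rP). Qed.

Lemma xcoord_Nr : exists x : S 0, xcoord x = - r.
Proof. by apply: (xcoord_surj iotaP U); rewrite sqrrN root_rP. Qed.

Lemma B0P (c : chains S 0) : aug c = 0 -> omega c = 0 -> c \in B0 S.
Proof.
move=> augc omegac; have [p pr] := xcoord_r; have [q qr] := xcoord_Nr.
(* The normal form of [c] modulo boundaries: every point is replaced by [p] or [q] according to its
   coordinate. *)
pose g c := omega c *: free2_gen p + (aug c - omega c) *: free2_gen q.
have gB : zmod_morphism g.
  move=> x y; rewrite /g omegaB augB opprD addrACA -opprD 2!scalerBl.
  by rewrite opprD addrACA.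
suff : \pi_HC c = \pi_HC (g c).
  rewrite /g augc omegac subrr !scale0r addr0 => /eqP.
  by rewrite -Quotient.idealrBE subr0.
apply: (@free2_ext _ _ \pi_HC (\pi_HC \o g)) => [x y|x y|x] /=.
- exact: (raddfB \pi_HC).
- by rewrite gB; exact: (raddfB \pi_HC).
- apply/eqP; rewrite -Quotient.idealrBE /g omega_gen aug_gen.
  case: (root_cases (xcoordP x)) => xr; rewrite xr ?eqxx ?oppr_r_neq.
    by rewrite subrr scale1r scale0r addr0 gen_B0 // pr.
  by rewrite subr0 scale1r scale0r add0r gen_B0 // qr.
Qed.

(** Computed on a chosen representative; [omegaC_pi] shows that the choice is harmless. *)
Definition omegaC (x : H0C S) : 'F_2 := omega (repr (x : HC)).

Lemma omegaC_pi c : omegaC (\pi_HC c) = omega c.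
Proof.
apply/eqP; rewrite -subr_eq0 -omegaB; apply/eqP.
have : repr (\pi_HC c) - c \in B0 S by rewrite Quotient.idealrBE reprK.
by move=> /asboolP[b <-]; exact: omega_boundary.
Qed.

Lemma omegaCB : zmod_morphism omegaC.
Proof.
move=> x y; rewrite -[x](@reprK _ HC) -[y](@reprK _ HC) -(raddfB \pi_HC).
by rewrite !omegaC_pi omegaB.
Qed.

Lemma H0C_augE c : H0C_aug S (\pi_HC c) = aug c.
Proof. exact: aug0_pi. Qed.

Lemma omegaC_act s (x : H0C S) : omegaC (gact s x) = omegaC x + chi s * H0C_aug S x.
Proof.
rewrite -[x](@reprK _ HC) H0C_augE omegaC_pi -omega_act -omegaC_pi.
by congr omegaC; exact: H0C_act_pi.
Qed.

Lemma H0C_eq (x y : H0C S) : H0C_aug S x = H0C_aug S y -> omegaC x = omegaC y -> x = y.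
Proof.
rewrite -[x](@reprK _ HC) -[y](@reprK _ HC) !H0C_augE !omegaC_pi => augxy omegaxy.
apply/eqP; rewrite -Quotient.idealrBE; apply: B0P.
  by rewrite augB augxy subrr.
by rewrite omegaB omegaxy subrr.
Qed.

Definition omegaF (x : H0F S) : 'F_2 := omegaC (H0F_incl S x).

Lemma omegaFB : zmod_morphism omegaF.
Proof. by move=> x y; rewrite /omegaF gmhB omegaCB. Qed.

Lemma H0F_inclE c : H0F_incl S (\pi_HF c) = \pi_HC (cyc c).
Proof. exact: incl_pi. Qed.

Lemma aug_incl (x : H0F S) : H0C_aug S (H0F_incl S x) = 0.
Proof.
by rewrite -[x](@reprK _ HF) H0F_inclE H0C_augE; exact/eqP/(valP (repr (x : HF))).
Qed.

Lemma omegaF_pi c : omegaF (\pi_HF c) = omega (cyc c).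
Proof. by rewrite /omegaF H0F_inclE omegaC_pi. Qed.

(** The Kummer term of [omegaC_act] is multiplied by the augmentation, which is 0 on $H_0(F)$; with
    [omegaF_inj] the action there is trivial. *)
Lemma omegaF_act s (x : H0F S) : omegaF (gact s x) = omegaF x.
Proof. by rewrite /omegaF gmh_act omegaC_act aug_incl mulr0 addr0. Qed.

Lemma omegaF_inj : injective omegaF.
Proof.
move=> x y; rewrite -[x](@reprK _ HF) -[y](@reprK _ HF) !omegaF_pi => omegaxy.
set c := repr _ in omegaxy *; set d := repr _ in omegaxy *.
apply/eqP; rewrite -Quotient.idealrBE.
have -> : (c - d \in B0F S) = (cyc c - cyc d \in B0 S) by [].
apply: B0P; last by rewrite omegaB omegaxy subrr.
by rewrite augB (eqP (valP c)) (eqP (valP d)) subrr.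
Qed.

Lemma omegaF_surj e : exists x, omegaF x = e.
Proof.
have [p pr] := xcoord_r; have [q qr] := xcoord_Nr.
have pq : free2_gen p - free2_gen q \in Z0F S.
  by rewrite unfold_in augB !aug_gen subrr.
case: (F2_cases e) => ->; first by exists 0; exact: zmorph0 omegaFB.
(* Of the two points of this reduced cycle exactly one lies over [r], since [r] and [- r] differ. *)
exists (\pi_HF (Cycle0 pq)).
by rewrite omegaF_pi omegaB !omega_gen pr qr eqxx oppr_r_neq subr0.
Qed.

(** The connecting cocycle does not depend on the lift [m] of [1]: changing [m]
    by a cycle changes [omegaC (s m)] and [omegaC m] by the same amount. *)
Lemma connecting_kummer (m : H0C S) (z : cocycle (H0F S)) : H0C_aug S m = 1 ->
  (forall s, H0F_incl S (z s) = gact s m - m) <-> (forall s, omegaF (z s) = chi s).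
Proof.
move=> augm; split=> zm s.
  by rewrite /omegaF zm omegaCB omegaC_act augm mulr1 addrAC subrr add0r.
apply: H0C_eq; first by rewrite aug_incl gmhB gmh_act subrr.
by rewrite omegaCB omegaC_act augm mulr1 addrAC subrr add0r -zm.
Qed.

Lemma H0C_aug_surj : exists m, H0C_aug S m = 1.
Proof.
have [p _] := xcoord_r; exists (\pi_HC (free2_gen p)).
by rewrite H0C_augE aug_gen.
Qed.

End Hypercovering.

(** * The pro-module $H_0(F)$ and the obstruction class *)

Lemma omegaF_map V U (h : hc_hom V U) (x : proH0F iota V) :
  omegaF (proH0F_map iota h x) = omegaF x.
Proof.
rewrite -[x](@reprK _ (Quotient.quot (B0F (Et iota V)))); move: (repr _) => c.
have -> : proH0F_map iota h (\pi_(Quotient.quot (B0F (Et iota V))) c) =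
    \pi_(Quotient.quot (B0F (Et iota U))) (Defs.cycle_map (Et_map iota h) c).
  exact: H0map_pi.
rewrite !omegaF_pi /=; move: (cyc c) => {}c.
apply: (free2_ext (f := @omega U \o chain_map (Et_map iota h) (n := 0))) c => [u v||u].
- by rewrite /= chain_mapB omegaB.
- exact: omegaB.
- by rewrite /= /chain_map free2_map_gen !omega_gen /= xcoord_map.
Qed.

Lemma reduced_homology_vanishes : reduced_homology_vanishes_below0 iota a.
Proof.
move=> U e; have [p _] := xcoord_r U.
by exists (e *: free2_gen p); case: (F2_cases e) => ->;
  rewrite ?scale0r ?(zmorph0 (@augB _)) ?scale1r ?aug_gen.
Qed.

Definition omegaF_inv (U : hypercovering a) (e : gmodZ2 iota) : proH0F iota U :=
  sval (cid (omegaF_surj U e)).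

Lemma omegaF_invK U e : omegaF (omegaF_inv U e) = e.
Proof. by rewrite /omegaF_inv; case: cid. Qed.

(** Additivity, equivariance and naturality pass from [omegaF] to its inverse by injectivity. *)
Definition Z2_iso_proH0F : iso_Z2_proH0F iota a.
Proof.
have invB U : zmod_morphism (omegaF_inv U).
  by move=> x y; apply: omegaF_inj; rewrite omegaFB !omegaF_invK.
have inv_act U s x : omegaF_inv U (gact s x) = gact s (omegaF_inv U x).
  by apply: omegaF_inj; rewrite omegaF_act !omegaF_invK.
exists (fun U => GModuleHom (invB U) (inv_act U)) => [U | V U h e].
- exists (@omegaF U) => [e | x]; first exact: omegaF_invK.
  by apply: omegaF_inj; rewrite omegaF_invK.
- by apply: omegaF_inj; rewrite omegaF_map !omegaF_invK.
Defined.

(** The group $\mathbb{Z}/2$ has only the identity automorphism, so every [psi U] is inverse to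
    [omegaF]. *)
Lemma omegaF_iso (psi : iso_Z2_proH0F iota a) U e : omegaF (psi U e) = e.
Proof.
have psi0 : psi U 0 = 0 := zmorph0 (gmhB (psi U)).
case: (F2_cases e) => ->; first by rewrite psi0 (zmorph0 (@omegaFB U)).
case: (F2_cases (omegaF (psi U 1))) => // /eqP.
rewrite -{1}(zmorph0 (@omegaFB U)) (inj_eq (@omegaF_inj U)) -psi0.
by rewrite (bij_eq (isoZ2_bij psi U)) oner_eq0.
Qed.

Lemma connectingP (psi : iso_Z2_proH0F iota a) U (c : H1 (proH0F iota U)) :
  connecting (H0F_incl (Et iota U)) (H0C_aug (Et iota U)) 1 c <->
  c = H1_map (psi U) (kummer_class iotaP charK a0).
Proof.
rewrite H1_map_pi; split=> [[m [z [augm /(connecting_kummer _ augm) zm ->]]] | ->].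
(* The coboundary is that of 0: [omegaF] shows that the two cocycles agree pointwise. *)
- apply/eqP; rewrite eqquotE; apply/asboolP; exists 0 => s.
  rewrite (zmorph0 (gactB s)) subrr; apply/eqP; rewrite subr_eq0; apply/eqP.
  by apply: omegaF_inj; rewrite zm omegaF_iso.
- have [m augm] := H0C_aug_surj U.
  exists m, (cocycle_map (psi U) (kummer_cocycle iotaP charK a0)); split=> //.
  by apply/(connecting_kummer _ augm) => s; exact: omegaF_iso.
Qed.

End HomologyOfX.

Lemma H1_proH0F_eqP (K Ks : fieldType) (iota : {rmorphism K -> Ks}) (a : K)
  (o o' : H1_proH0F iota a) : (forall U, o U = o' U) -> o = o'.
Proof.
case: o o' => o1 o2 [o1' o2'] /= e.
have e1 : o1 = o1' by exact: functional_extensionality_dep.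
by subst o1'; congr H1Pro; exact: Prop_irrelevance.
Qed.

(** The first two conjuncts justify $d=0$ and the coefficients $\mathbb{Z}/2$; the equivalence
    yields both existence and uniqueness of the obstruction, for any identification [psi]. *)
Theorem proposition5p1p1 (K Ks : fieldType) (iota : {rmorphism K -> Ks})
    (iotaP : is_separable_closure iota) (charK : (2 \notin [pchar K])%N)
    (a : K) (a0 : a != 0) :
  [/\ reduced_homology_vanishes_below0 iota a,
      inhabited (iso_Z2_proH0F iota a)
    & forall (psi : iso_Z2_proH0F iota a) (o : H1_proH0F iota a),
        is_first_obstruction o <-> o = iso_H1 psi (kummer_class iotaP charK a0)].
Proof.
split=> [||psi o]; first exact: (reduced_homology_vanishes iotaP charK a0).
- exact: (inhabits (Z2_iso_proH0F iotaP charK a0)).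
- split=> [obs | -> U]; last exact/connectingP.
  by apply: H1_proH0F_eqP => U; exact/connectingP.
Qed.
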